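(* Let $G$ be a group, let $(H,\mathcal{E}_{\mathcal{I}})$ and $(K,\mathcal{E}_{\mathcal{J}})$ be two coarse groups (with $\mathcal{I}$ a group ideal on $H$ and $\mathcal{J}$ a group ideal on $K$), let $f\colon G\to H$ be a quasi-homomorphism, and let $g\colon H\to K$ be a bornologous quasi-homomorphism. Then $g\circ f\colon G\to K$ is a quasi-homomorphism.
   Context: A group ideal $\mathcal{I}$ on a group $H$ is a family of subsets of $H$ containing $\{e\}$ and closed under subsets, finite unions, products $AB=\{ab\mid a\in A, b\in B\}$ and inverses $A^{-1}=\{a^{-1}\mid a\in A\}$. For $A\in\mathcal{I}$ put $E_A=\{(h,ha)\mid h\in H,\,a\in A\}$. The coarse group $(H,\mathcal{E}_{\mathcal{I}})$ is $H$ endowed with the (left) coarse structure $\mathcal{E}_{\mathcal{I}}=\{E\subseteq H\times H\mid \exists A\in\mathcal{I}:\ E\subseteq E_A\}$. A map $f\colon G\to(H,\mathcal{E}_{\mathcal{I}})$ from a group to a coarse group is a quasi-homomorphism if there exists $A\in\mathcal{I}$ such that $f(xy)\in f(x)f(y)A$ for all $x,y\in G$. A map $g\colon(X,\mathcal{E}_X)\to(Y,\mathcal{E}_Y)$ between sets with coarse structures is bornologous if $(g\times g)(E)\in\mathcal{E}_Y$ for all $E\in\mathcal{E}_X$. *)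

(* Defs.v *)
From HB Require Import structures.
From mathcomp Require Import all_boot.
From mathcomp Require Import boolp classical_sets.

Set Implicit Arguments.
Unset Strict Implicit.
Unset Printing Implicit Defensive.

Import Algebra.

Local Open Scope classical_set_scope.
Local Open Scope group_scope.

(* Only binary unions are required: the empty union is a subset of [set 1]. *)
Record groupIdeal (H : groupType) := GroupIdeal {
  ideal_sets :> set H -> Prop;
  ideal_set1 : ideal_sets [set 1];
  ideal_sub : forall A B : set H, A `<=` B -> ideal_sets B -> ideal_sets A;
  ideal_setU : forall A B : set H,
    ideal_sets A -> ideal_sets B -> ideal_sets (A `|` B);
  ideal_mul : forall A B : set H,
    ideal_sets A -> ideal_sets B ->
    ideal_sets [set a * b | a in A & b in B];
  ideal_inv : forall A : set H,
    ideal_sets A -> ideal_sets [set a^-1 | a in A] }.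

Record coarseStructure (X : Type) := CoarseStructure {
  coarse_sets :> set (X * X) -> Prop;
  coarse_diag : coarse_sets diagonal;
  coarse_sub : forall E F : set (X * X),
    E `<=` F -> coarse_sets F -> coarse_sets E;
  coarse_setU : forall E F : set (X * X),
    coarse_sets E -> coarse_sets F -> coarse_sets (E `|` F);
  coarse_comp : forall E F : set (X * X),
    coarse_sets E -> coarse_sets F -> coarse_sets (E \; F)%relation;
  coarse_inv : forall E : set (X * X),
    coarse_sets E -> coarse_sets (E^-1)%relation }.

Definition bornologous (X Y : Type) (EX : coarseStructure X)
    (EY : coarseStructure Y) (g : X -> Y) : Prop :=
  forall E : set (X * X), EX E -> EY [set (g p.1, g p.2) | p in E].

Definition translation_entourage (H : groupType) (A : set H) : set (H * H) :=
  [set (h, h * a) | h in setT & a in A].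

Definition ideal_coarse_sets (H : groupType) (I : groupIdeal H) :
    set (set (H * H)) :=
  [set E | exists2 A, I A & E `<=` translation_entourage A].

Lemma ideal_coarse_diag (H : groupType) (I : groupIdeal H) :
  ideal_coarse_sets I diagonal.
Proof.
exists [set 1]; first exact: ideal_set1.
by move=> [h k] /diagonalP <-; exists h => //; exists 1; rewrite ?mulg1.
Qed.

Lemma ideal_coarse_sub (H : groupType) (I : groupIdeal H)
    (E F : set (H * H)) :
  E `<=` F -> ideal_coarse_sets I F -> ideal_coarse_sets I E.
Proof. by move=> EF [A IA FA]; exists A => // p /EF /FA. Qed.

Lemma ideal_coarse_setU (H : groupType) (I : groupIdeal H)
    (E F : set (H * H)) :
  ideal_coarse_sets I E -> ideal_coarse_sets I F ->
  ideal_coarse_sets I (E `|` F).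
Proof.
move=> [A IA EA] [B IB FB]; exists (A `|` B); first exact: ideal_setU.
move=> p [/EA|/FB] [h _ [a Aa <-]]; exists h => //; exists a => //;
  by [left | right].
Qed.

Lemma ideal_coarse_comp (H : groupType) (I : groupIdeal H)
    (E F : set (H * H)) :
  ideal_coarse_sets I E -> ideal_coarse_sets I F ->
  ideal_coarse_sets I (E \; F)%relation.
Proof.
move=> [A IA EA] [B IB FB]; exists [set b * a | b in B & a in A].
  exact: ideal_mul.
move=> [x z] [y Fxy Eyz].
have [h _ [b Bb [<- hby]]] := FB _ Fxy.
have [_ _ [a Aa [-> <-]]] := EA _ Eyz; rewrite -hby.
by exists h => //; exists (b * a); [exists b => //; exists a | rewrite mulgA].
Qed.

Lemma ideal_coarse_inv (H : groupType) (I : groupIdeal H)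
    (E : set (H * H)) :
  ideal_coarse_sets I E -> ideal_coarse_sets I (E^-1)%relation.
Proof.
move=> [A IA EA]; exists [set a^-1 | a in A]; first exact: ideal_inv.
move=> [x y] Eyx; have [h _ [a Aa [<- <-]]] := EA _ Eyx.
by exists (h * a) => //; exists a^-1; [exists a | rewrite mulgK].
Qed.

Definition ideal_coarse (H : groupType) (I : groupIdeal H) :
    coarseStructure H :=
  CoarseStructure (@ideal_coarse_diag H I) (@ideal_coarse_sub H I)
    (@ideal_coarse_setU H I) (@ideal_coarse_comp H I) (@ideal_coarse_inv H I).

Definition quasi_homomorphism (G H : groupType) (I : groupIdeal H)
    (f : G -> H) : Prop :=
  exists2 A : set H, I A &
    forall x y : G, [set f x * f y * a | a in A] (f (x * y)).

(* Main.v *)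
Require Import Defs.
From mathcomp Require Import all_boot.
From mathcomp Require Import boolp classical_sets.

Import Algebra.

(** The defect of [f] says that the pairs [(f x * f y, f (x * y))] all lie in a
    single entourage of [H].  A bornologous [g] sends them into an entourage
    [E_B] of [K], so that [g (f (x * y))] lies in [g (f x * f y) B], and the
    defect [C] of [g] puts the latter in [g (f x) g (f y) C B].  Hence the
    product [C B], which the ideal [J] contains, bounds the defect of the
    composite uniformly in [x] and [y]. *)

Theorem proposition4p8 (G H K : groupType) (I : groupIdeal H)
    (J : groupIdeal K) (f : G -> H) (g : H -> K)
    (hf : quasi_homomorphism I f)
    (hgb : bornologous (ideal_coarse I) (ideal_coarse J) g)
    (hgq : quasi_homomorphism J g) :
  quasi_homomorphism J (g \o f).
Proof.
case: hf => A IA fA; case: hgq => C JC gC.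
have [|B JB gB] := hgb (translation_entourage A); first by exists A.
exists [set c * b | c in C & b in B]%classic%g; first exact: ideal_mul.
move=> x y /=.
have [a Aa fxy] := fA x y.
have [c Cc gfxy] := gC (f x) (f y).
have [|_ _ [b Bb [-> gfb]]] := gB (g (f x * f y)%g, g (f (x * y)%g)).
  exists (f x * f y, f (x * y))%g => //.
  by exists (f x * f y)%g => //; exists a => //; rewrite fxy.
exists (c * b)%g; first by exists c => //; exists b.
by rewrite mulgA gfxy.
Qed.
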